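(* The map $\phi$ from the Riordan group to the Double Riordan group defined by \[ \phi(g,f)=\Big(g(z^2),\ z,\ \tfrac{f(z^2)}{z}\Big) \] is a group monomorphism (injective group homomorphism). Consequently the type-1 almost Appell subgroup $\{(g(z^2),z,f(z^2)/z): g\in\mathcal{F}_0,\ f\in\mathcal{F}_1\}$ of the Double Riordan group is isomorphic to the Riordan group.
   Context: Work with formal power series in $z$ over $\mathbb{C}$. Let $\mathcal{F}_0$ be the set of formal power series with nonzero constant term, and $\mathcal{F}_1$ the set of formal power series with zero constant term and nonzero coefficient of $z$. The Riordan group consists of the Riordan arrays $(g,f)$ with $g\in\mathcal{F}_0$, $f\in\mathcal{F}_1$, i.e. infinite lower-triangular matrices whose $k$th column ($k\ge 0$) has generating function $g f^k$; the group operation is matrix multiplication, given by $(g,f)*(G,F)=(g\,G(f),\ F(f))$, with identity $(1,z)$. A Double Riordan array $(g,f_1,f_2)$ is given by an even series $g\in\mathcal{F}_0$ and odd series $f_1,f_2\in\mathcal{F}_1$; it is the infinite lower-triangular matrix whose columns have generating functions $g,\ gf_1,\ gf_1f_2,\ gf_1(f_1f_2),\ g(f_1f_2)^2,\dots$ (multiplying alternately by $f_1$ and $f_2$). The Double Riordan group is the set of these arrays under matrix multiplication, which is given by $(g,f_1,f_2)*(G,F_1,F_2)=\big(g\,G(h),\ \tfrac{f_1}{h}F_1(h),\ \tfrac{f_2}{h}F_2(h)\big)$ with $h=\sqrt{f_1f_2}\in\mathcal{F}_1$ (independent of the choice of root). *)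

(* Defs.v *)
From HB Require Import structures.
From mathcomp Require Import all_boot all_order all_algebra.
From mathcomp Require Import boolp.

Set Implicit Arguments.
Unset Strict Implicit.
Unset Printing Implicit Defensive.

Import GRing.Theory.
Local Open Scope ring_scope.

(* A formal power series is its sequence of coefficients. The wrapper keeps   *)
(* the Cauchy product apart from pointwise multiplication of functions.       *)
Record fps (K : Type) := Fps { fcoef :> nat -> K }.

HB.instance Definition _ (K : Type) := gen_eqMixin (fps K).
HB.instance Definition _ (K : Type) := gen_choiceMixin (fps K).

Lemma fpsP (K : Type) (f g : fps K) : (forall n, f n = g n) -> f = g.
Proof. by case: f => f; case: g => g /= /funext ->. Qed.

Section FpsRing.
Variable K : fieldType.
Implicit Types f g h : fps K.

Definition fps_zero : fps K := Fps (fun _ => 0).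
Definition fps_opp f : fps K := Fps (fun n => - f n).
Definition fps_add f g : fps K := Fps (fun n => f n + g n).
Definition fps_one : fps K := Fps (fun n => (n == 0)%:R).
Definition fps_mul f g : fps K :=
  Fps (fun n => \sum_(i < n.+1) f i * g (n - i)%N).

Definition ftrunc N f : {poly K} := \poly_(i < N.+1) f i.

Lemma coef_ftrunc N f i : (i <= N)%N -> (ftrunc N f)`_i = f i.
Proof. by move=> iN; rewrite coef_poly ltnS iN. Qed.

Lemma ftrunc_mul N f g i : (i <= N)%N ->
  (ftrunc N f * ftrunc N g)`_i = fps_mul f g i.
Proof.
move=> iN; rewrite coefM /=; apply: eq_bigr => j _.
rewrite !coef_ftrunc //; first exact: leq_trans (leq_subr _ _) iN.
by apply: leq_trans iN; rewrite -ltnS.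
Qed.

Lemma coefM_eq N (p q p' q' : {poly K}) :
  (forall i, (i <= N)%N -> p`_i = p'`_i) ->
  (forall i, (i <= N)%N -> q`_i = q'`_i) ->
  forall i, (i <= N)%N -> (p * q)`_i = (p' * q')`_i.
Proof.
move=> pp qq i iN; rewrite !coefM; apply: eq_bigr => j _.
rewrite pp ?qq //; first exact: leq_trans (leq_subr _ _) iN.
by apply: leq_trans iN; rewrite -ltnS.
Qed.

Fact fps_addA : associative fps_add.
Proof. by move=> f g h; apply: fpsP => n /=; rewrite addrA. Qed.
Fact fps_addC : commutative fps_add.
Proof. by move=> f g; apply: fpsP => n /=; rewrite addrC. Qed.
Fact fps_add0 : left_id fps_zero fps_add.
Proof. by move=> f; apply: fpsP => n /=; rewrite add0r. Qed.
Fact fps_addN : left_inverse fps_zero fps_opp fps_add.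
Proof. by move=> f; apply: fpsP => n /=; rewrite addNr. Qed.

HB.instance Definition _ :=
  GRing.isZmodule.Build (fps K) fps_addA fps_addC fps_add0 fps_addN.

Fact fps_mulA : associative fps_mul.
Proof.
move=> f g h; apply: fpsP => n; rewrite -!(@ftrunc_mul n) //.
rewrite (@coefM_eq n _ _ (ftrunc n f) (ftrunc n g * ftrunc n h)) //; last first.
  by move=> i iN; rewrite ftrunc_mul // coef_ftrunc.
rewrite mulrA; apply: (@coefM_eq n) => // i iN.
by rewrite ftrunc_mul // coef_ftrunc.
Qed.
Fact fps_mulC : commutative fps_mul.
Proof.
by move=> f g; apply: fpsP => n; rewrite -!(@ftrunc_mul n) // mulrC.
Qed.
Fact fps_mul1 : left_id fps_one fps_mul.
Proof.
move=> f; apply: fpsP => n /=.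
by rewrite big_ord_recl /= mul1r subn0 big1 ?addr0 // => i _; rewrite mul0r.
Qed.
Fact fps_mulDl : left_distributive fps_mul fps_add.
Proof.
move=> f g h; apply: fpsP => n /=; rewrite -big_split /=.
by apply: eq_bigr => i _; rewrite mulrDl.
Qed.
Fact fps_one_neq0 : fps_one != 0.
Proof.
by apply/eqP => /(congr1 (fun f : fps K => f 0%N)) /= /eqP; rewrite oner_eq0.
Qed.

HB.instance Definition _ := GRing.Zmodule_isComNzRing.Build (fps K)
  fps_mulA fps_mulC fps_mul1 fps_mulDl fps_one_neq0.

Lemma fpsME f g n : (f * g) n = \sum_(i < n.+1) f i * g (n - i)%N.
Proof. by []. Qed.

Lemma fpsDE f g n : (f + g) n = f n + g n. Proof. by []. Qed.

Lemma fps1E n : (1 : fps K) n = (n == 0)%:R. Proof. by []. Qed.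

Lemma fps_sumE (I : Type) (r : seq I) (P : pred I) (F : I -> fps K) n :
  (\sum_(i <- r | P i) F i) n = \sum_(i <- r | P i) F i n.
Proof. by apply: (big_morph (fun f : fps K => f n)). Qed.

Definition fpsX : fps K := Fps (fun n => (n == 1)%:R).
Definition fpsC (c : K) : fps K := Fps (fun n => if n == 0 then c else 0).

Lemma fpsXME f n : (fpsX * f) n = if n is m.+1 then f m else 0.
Proof.
case: n => [|m]; first by rewrite fpsME big_ord1 /= mul0r.
rewrite fpsME big_ord_recl /= mul0r add0r big_ord_recl /= subSS subn0 mul1r.
by rewrite big1 ?addr0 // => i _; rewrite mul0r.
Qed.

Lemma fpsXnE k n : (fpsX ^+ k) n = (n == k)%:R.
Proof.
by elim: k n => [|k IH] n; rewrite ?expr0 // exprS fpsXME; case: n.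
Qed.

Lemma fpsM0E f g : (f * g) 0 = f 0 * g 0.
Proof. by rewrite fpsME big_ord1. Qed.

Lemma fpsXn0E f k : (f ^+ k) 0 = f 0 ^+ k.
Proof. by elim: k => [|k IH] //; rewrite !exprS fpsM0E IH. Qed.

Lemma fpsCME c f n : (fpsC c * f) n = c * f n.
Proof.
by rewrite fpsME big_ord_recl /= subn0 big1 ?addr0 // => i _; rewrite mul0r.
Qed.

Fact fpsC_additive : zmod_morphism fpsC.
Proof.
by move=> a b; apply: fpsP => n /=; case: eqP; rewrite ?subrr.
Qed.
Fact fpsC_multiplicative : monoid_morphism fpsC.
Proof.
split=> [|a b]; apply: fpsP => n; first by case: n.
by rewrite fpsCME /=; case: eqP; rewrite ?mulr0.
Qed.
HB.instance Definition _ := GRing.isZmodMorphism.Build K (fps K) fpsC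
  fpsC_additive.
HB.instance Definition _ := GRing.isMonoidMorphism.Build K (fps K) fpsC
  fpsC_multiplicative.

Definition fps_unit0 : {pred fps K} := fun f => f 0 != 0.
Definition fps_ord1 : {pred fps K} := fun f => (f 0 == 0) && (f 1 != 0).

Definition fps_even f := forall n, odd n -> f n = 0.
Definition fps_odd f := forall n, ~~ odd n -> f n = 0.

(* [fps_comp a f] is a(f); it is meaningful when f has zero constant term,    *)
(* since then f ^+ k has no coefficient of index less than k.                 *)
Definition fps_comp (a f : fps K) : fps K :=
  Fps (fun n => \sum_(k < n.+1) a k * (f ^+ k) n).

(* [fps_divX f] is f / z; it is meaningful when f has zero constant term. *)
Definition fps_divX f : fps K := Fps (fun n => f n.+1).

Lemma fps_divXK f : f 0 = 0 -> fpsX * fps_divX f = f.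
Proof. by move=> f0; apply: fpsP => -[|n]; rewrite fpsXME. Qed.

Lemma fps_expE f k n : f 0 = 0 -> (n < k)%N -> (f ^+ k) n = 0.
Proof.
move=> f0 nk; rewrite -(fps_divXK f0) exprMn fpsME big1 // => i _.
rewrite fpsXnE ltn_eqF ?mul0r //.
by apply: leq_ltn_trans nk; rewrite -ltnS.
Qed.

Lemma fps_exp_diag f n : f 0 = 0 -> (f ^+ n) n = f 1 ^+ n.
Proof.
move=> f0; rewrite -{1}(fps_divXK f0) exprMn fpsME big_ord_recr /=.
rewrite fpsXnE eqxx mul1r subnn fpsXn0E /= big1 ?add0r // => i _.
by rewrite fpsXnE ltn_eqF ?mul0r.
Qed.

Lemma fps_comp_wide N (a f : fps K) n : f 0 = 0 -> (n <= N)%N ->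
  fps_comp a f n = \sum_(k < N.+1) a k * (f ^+ k) n.
Proof.
move=> f0 nN /=; rewrite (big_ord_widen N.+1 (fun k => a k * (f ^+ k) n)) //.
rewrite [RHS](bigID (fun k : 'I_N.+1 => (k < n.+1)%N)) /= [X in _ + X]big1.
  by rewrite addr0.
by move=> i; rewrite -leqNgt => ni; rewrite fps_expE ?mulr0.
Qed.

Lemma fps_comp_poly (p : {poly K}) (a f : fps K) N n :
  f 0 = 0 -> (n <= N)%N -> (forall i, (i <= N)%N -> p`_i = a i) ->
  (map_poly fpsC p).[f] n = fps_comp a f n.
Proof.
move=> f0 nN pa.
rewrite (@horner_coef_wide _ (maxn (size p) N.+1)); last first.
  by rewrite (leq_trans (size_poly _ _)) // leq_maxl.
rewrite fps_sumE.
have aux i : ((map_poly fpsC p)`_i * f ^+ i) n = p`_i * (f ^+ i) n.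
  by rewrite coef_map fpsCME.
under eq_bigr => i _ do rewrite aux.
rewrite (fps_comp_wide _ f0 nN) (big_ord_widen (maxn (size p) N.+1)
  (fun k => a k * (f ^+ k) n)) ?leq_maxr //.
rewrite [LHS](bigID (fun k : 'I_(maxn (size p) N.+1) => (k < N.+1)%N)) /=.
rewrite [X in _ + X]big1 ?addr0; first by apply: eq_bigr => i iN; rewrite pa.
move=> i; rewrite -leqNgt => Ni.
by rewrite fps_expE ?mulr0 //; apply: leq_ltn_trans Ni.
Qed.

Lemma fps_compM (a b f : fps K) : f 0 = 0 ->
  fps_comp (a * b) f = fps_comp a f * fps_comp b f.
Proof.
move=> f0; apply: fpsP => n.
rewrite -(@fps_comp_poly (ftrunc n a * ftrunc n b) (a * b) f n n) //; last first.
  by move=> i iN; rewrite ftrunc_mul.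
rewrite rmorphM /= hornerM !fpsME; apply: eq_bigr => i _.
congr (_ * _); apply: (@fps_comp_poly _ _ _ n) => //.
- by rewrite -ltnS.
- by move=> j jn; rewrite coef_ftrunc.
- exact: leq_subr.
- by move=> j jn; rewrite coef_ftrunc.
Qed.

Lemma fps_comp1 f : fps_comp 1 f = 1.
Proof.
apply: fpsP => n /=; rewrite big_ord_recl /= mul1r.
by rewrite big1 ?addr0 // => i _; rewrite mul0r.
Qed.

Lemma fps_compXn (a f : fps K) k : f 0 = 0 ->
  fps_comp (a ^+ k) f = fps_comp a f ^+ k.
Proof.
by move=> f0; elim: k => [|k IH]; rewrite ?fps_comp1 // !exprS fps_compM ?IH.
Qed.

Lemma fps_compXf f : f 0 = 0 -> fps_comp fpsX f = f.
Proof.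
move=> f0; apply: fpsP => n; rewrite (@fps_comp_wide n.+1) // big_ord_recl /=.
rewrite mul0r add0r big_ord_recl /= mul1r expr1 big1 ?addr0 // => i _.
by rewrite mul0r.
Qed.

Lemma fps_comp0E (a f : fps K) : fps_comp a f 0 = a 0.
Proof. by rewrite /= big_ord1 expr0 mulr1. Qed.

Lemma fps_compA (a f h : fps K) : f 0 = 0 -> h 0 = 0 ->
  fps_comp (fps_comp a f) h = fps_comp a (fps_comp f h).
Proof.
move=> f0 h0; apply: fpsP => n.
have c0 : fps_comp f h 0 = 0 by rewrite fps_comp0E.
rewrite (fps_comp_wide _ h0 (leqnn n)).
transitivity (\sum_(j < n.+1) \sum_(k < n.+1) a k * ((f ^+ k) j * (h ^+ j) n)).
  apply: eq_bigr => j _.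
  rewrite (@fps_comp_wide n _ _ j) //; last by rewrite -ltnS.
  by rewrite mulr_suml; apply: eq_bigr => k _; rewrite mulrA.
rewrite exchange_big; apply: eq_bigr => k _; rewrite -mulr_sumr.
by rewrite -fps_compXn.
Qed.

Lemma fps_comp_ord1 (a f : fps K) : a \in fps_ord1 -> f \in fps_ord1 ->
  fps_comp a f \in fps_ord1.
Proof.
rewrite !unfold_in => /andP[/eqP a0 a1] /andP[/eqP f0 f1].
rewrite fps_comp0E a0 eqxx /= big_ord_recl big_ord1 /= a0 mul0r add0r expr1.
exact: mulf_neq0.
Qed.

Lemma fps_comp_unit0 (a f : fps K) : a \in fps_unit0 ->
  fps_comp a f \in fps_unit0.
Proof. by rewrite !unfold_in fps_comp0E. Qed.

Lemma fps_unit0M f g : f \in fps_unit0 -> g \in fps_unit0 ->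
  f * g \in fps_unit0.
Proof. by rewrite !unfold_in fpsM0E; apply: mulf_neq0. Qed.

Lemma fps_ord1_0 f : f \in fps_ord1 -> f 0 = 0.
Proof. by rewrite unfold_in => /andP[/eqP]. Qed.

Lemma fps_mulX_ord1 f : (fpsX * f \in fps_ord1) = (f \in fps_unit0).
Proof. by rewrite !unfold_in !fpsXME eqxx. Qed.

Lemma fps_mulXI : injective (fun f : fps K => fpsX * f).
Proof.
move=> f g /= fg; apply: fpsP => n.
by have := congr1 (fun h : fps K => h n.+1) fg; rewrite !fpsXME.
Qed.

(* The substitution f(z^2). *)
Definition fps_sq f : fps K := fps_comp f (fpsX ^+ 2).

Lemma fpsX2_0 : (fpsX ^+ 2 : fps K) 0 = 0. Proof. by rewrite fpsXnE. Qed.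

Lemma fps_sqE f n : fps_sq f n = if odd n then 0 else f n./2.
Proof.
rewrite /=.
have aux k : f k * ((fpsX ^+ 2) ^+ k) n = if n == k.*2 then f k else 0.
  by rewrite -exprM fpsXnE mul2n; case: eqP; rewrite ?mulr1 ?mulr0.
under eq_bigr => k _ do rewrite aux.
case: ifPn => on.
  rewrite big1 // => k _; case: eqP => // nk.
  by rewrite nk odd_double in on.
have nE : n = n./2.*2 by rewrite even_halfK.
have lt : (n./2 < n.+1)%N by rewrite ltnS leq_half_double -addnn -addnS leq_addr.
rewrite (bigD1 (Ordinal lt)) //= -nE eqxx big1 ?addr0 // => k /eqP kn.
case: eqP => // nk; case: kn; apply: val_inj => /=.
by rewrite -(doubleK k) -nk.
Qed.

Lemma fps_sqM f g : fps_sq (f * g) = fps_sq f * fps_sq g.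
Proof. exact/fps_compM/fpsX2_0. Qed.

Lemma fps_sqXn f k : fps_sq (f ^+ k) = fps_sq f ^+ k.
Proof. exact/fps_compXn/fpsX2_0. Qed.

Lemma fps_sqX : fps_sq fpsX = fpsX ^+ 2.
Proof. exact/fps_compXf/fpsX2_0. Qed.

Lemma fps_sq_even f : fps_even (fps_sq f).
Proof. by move=> n on; rewrite fps_sqE on. Qed.

Lemma fps_mulX_odd f : fps_even f -> fps_odd (fpsX * f).
Proof. by move=> ef [|n]; rewrite fpsXME //= negbK => /ef. Qed.

Lemma fps_sq_unit0 f : (fps_sq f \in fps_unit0) = (f \in fps_unit0).
Proof. by rewrite !unfold_in fps_sqE. Qed.

Lemma fps_sq_inj : injective fps_sq.
Proof.
move=> f g fg; apply: fpsP => n.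
have := congr1 (fun h : fps K => h n.*2) fg.
by rewrite !fps_sqE odd_double doubleK.
Qed.

Lemma fps_evenP f : fps_even f -> exists a, f = fps_sq a.
Proof.
move=> ef; exists (Fps (fun n => f n.*2)); apply: fpsP => n.
by rewrite fps_sqE /=; case: ifPn => [/ef //|on]; rewrite even_halfK.
Qed.

Lemma fps_oddP f : fps_odd f -> exists a, f = fpsX * fps_sq a.
Proof.
move=> of_; have [a fa] : exists a, fps_divX f = fps_sq a.
  by apply: fps_evenP => n on /=; rewrite of_ //= on.
by exists a; rewrite -fa fps_divXK // of_.
Qed.

Lemma fps_divX_sqE f : f 0 = 0 -> fps_divX (fps_sq f) = fpsX * fps_sq (fps_divX f).
Proof.
move=> f0; apply: fps_mulXI; rewrite fps_divXK ?fps_sqE //.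
by rewrite mulrA -expr2 -fps_sqX -fps_sqM fps_divXK.
Qed.

Lemma fps_divX_sq_odd f : f \in fps_ord1 -> fps_odd (fps_divX (fps_sq f)).
Proof.
move=> /fps_ord1_0 f0; rewrite fps_divX_sqE //.
exact/fps_mulX_odd/fps_sq_even.
Qed.

Lemma fps_divX_unit0 f : f \in fps_ord1 -> fps_divX f \in fps_unit0.
Proof. by rewrite !unfold_in => /andP[]. Qed.

Lemma fps_divX_sq_ord1 f : f \in fps_ord1 ->
  fps_divX (fps_sq f) \in fps_ord1.
Proof.
move=> f1; have f0 := fps_ord1_0 f1.
by rewrite fps_divX_sqE // fps_mulX_ord1 fps_sq_unit0 fps_divX_unit0.
Qed.

Lemma fpsX_odd : fps_odd fpsX.
Proof. by case=> [|[]]. Qed.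

Lemma fpsX_ord1 : fpsX \in fps_ord1.
Proof. by rewrite unfold_in /= eqxx oner_eq0. Qed.

End FpsRing.

Arguments fpsX {K}.
Arguments fps_unit0 {K}.
Arguments fps_ord1 {K}.

Section TriangularGroup.
Variable K : fieldType.

Definition lt_invertible (A : nat -> nat -> K) :=
  (forall i j, (i < j)%N -> A i j = 0) /\ (forall i, A i i != 0).

(* Infinite lower triangular matrices with nonzero diagonal, i.e. the         *)
(* invertible infinite lower triangular matrices.                             *)
Record ltmatrix := LTMatrix {
  ltm_entry :> nat -> nat -> K;
  ltmatrixP : lt_invertible ltm_entry }.

HB.instance Definition _ := gen_eqMixin ltmatrix.
HB.instance Definition _ := gen_choiceMixin ltmatrix.

Implicit Types A B C : ltmatrix.

Lemma ltm_eq A B : (forall i j, A i j = B i j) -> A = B.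
Proof.
case: A => A HA; case: B => B HB /= AB.
have {AB}AB : A = B by apply/funext => i; apply/funext => j.
by case: B / AB HB => HB; congr LTMatrix; apply: Prop_irrelevance.
Qed.

Lemma ltm_up A i j : (i < j)%N -> A i j = 0.
Proof. exact: (ltmatrixP A).1. Qed.
Lemma ltm_diag A i : A i i != 0.
Proof. exact: (ltmatrixP A).2. Qed.

(* The sum over all k of A i k * B k j, whose terms vanish for k > i. *)
Definition ltm_mul_entry (A B : nat -> nat -> K) i j :=
  \sum_(k < i.+1) A i k * B k j.

Fact ltm_mul_subproof A B : lt_invertible (ltm_mul_entry A B).
Proof.
split=> [i j ij|i]; rewrite /ltm_mul_entry.
  rewrite big1 // => k _; rewrite [B _ _]ltm_up ?mulr0 //.
  by apply: leq_ltn_trans ij; rewrite -ltnS.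
rewrite big_ord_recr /= big1 ?add0r ?mulf_neq0 ?ltm_diag // => k _.
by rewrite [B _ _]ltm_up ?mulr0.
Qed.
Definition ltm_mul A B := LTMatrix (ltm_mul_subproof A B).

Fact ltm_one_subproof : lt_invertible (fun i j => (i == j)%:R).
Proof.
split=> [i j ij|i] /=; first by rewrite ltn_eqF.
by rewrite eqxx oner_neq0.
Qed.
Definition ltm_one := LTMatrix ltm_one_subproof.

Lemma ltm_mul_wide N A B i j : (i <= N)%N ->
  ltm_mul A B i j = \sum_(k < N.+1) A i k * B k j.
Proof.
move=> iN; rewrite /= /ltm_mul_entry.
rewrite (big_ord_widen N.+1 (fun k => A i k * B k j)) //.
rewrite [RHS](bigID (fun k : 'I_N.+1 => (k < i.+1)%N)) /= [X in _ + X]big1.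
  by rewrite addr0.
by move=> k; rewrite -leqNgt => ik; rewrite ltm_up ?mul0r.
Qed.

Fact ltm_mulA : associative ltm_mul.
Proof.
move=> A B C; apply: ltm_eq => i j.
transitivity (\sum_(k < i.+1) \sum_(l < i.+1) A i k * (B k l * C l j)).
  apply: eq_bigr => k _; rewrite (@ltm_mul_wide i) ?mulr_sumr //.
  by rewrite -ltnS.
rewrite exchange_big; apply: eq_bigr => l _ /=.
by rewrite mulr_suml; apply: eq_bigr => k _; rewrite mulrA.
Qed.

Fact ltm_mul1 : right_id ltm_one ltm_mul.
Proof.
move=> A; apply: ltm_eq => i j /=; rewrite /ltm_mul_entry /=.
have aux k : A i k * (k == j)%:R = if k == j then A i j else 0.
  by case: eqP => [->|_]; rewrite ?mulr1 ?mulr0.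
under eq_bigr => k _ do rewrite aux.
case: (ltnP i j) => ij.
  rewrite ltm_up // big1 // => k _; case: eqP => //.
have lt : (j < i.+1)%N by [].
rewrite (bigD1 (Ordinal lt)) //= eqxx big1 ?addr0 // => k /eqP kj.
by case: eqP => // kj'; case: kj; apply: val_inj.
Qed.

Fact ltm_1mul : left_id ltm_one ltm_mul.
Proof.
move=> A; apply: ltm_eq => i j /=; rewrite /ltm_mul_entry /=.
rewrite big_ord_recr /= eqxx mul1r big1 ?add0r // => k _.
by rewrite gtn_eqF ?mul0r.
Qed.

Fixpoint ltm_solve_seq A (b : nat -> K) n : seq K :=
  if n is m.+1 then
    let s := ltm_solve_seq A b m in
    rcons s ((b m - \sum_(k < m) A m k * s`_k) / A m m)
  else [::].

Definition ltm_solve A b n := (ltm_solve_seq A b n.+1)`_n.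

Lemma size_ltm_solve_seq A b n : size (ltm_solve_seq A b n) = n.
Proof. by elim: n => //= n IH; rewrite size_rcons IH. Qed.

Lemma nth_ltm_solve_seq A b N n : (n < N)%N ->
  (ltm_solve_seq A b N)`_n = ltm_solve A b n.
Proof.
elim: N => // N IH; rewrite ltnS leq_eqVlt => /orP[/eqP-> //|nN].
by rewrite /= nth_rcons size_ltm_solve_seq nN IH.
Qed.

Lemma ltm_solveP A b n : \sum_(k < n.+1) A n k * ltm_solve A b k = b n.
Proof.
rewrite big_ord_recr /= {2}/ltm_solve /= nth_rcons size_ltm_solve_seq.
rewrite ltnn eqxx mulrCA divff ?ltm_diag // mulr1.
rewrite [X in _ + (_ - X)](_ : _ = \sum_(k < n) A n k * ltm_solve A b k).
  by rewrite addrC subrK.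
by apply: eq_bigr => k _; rewrite nth_ltm_solve_seq.
Qed.

Fact ltm_inv_subproof A :
  lt_invertible (fun i j => ltm_solve A (fun k => (k == j)%:R) i).
Proof.
have up i j : (i < j)%N -> ltm_solve A (fun k => (k == j)%:R) i = 0.
  elim/ltn_ind: i => i IH ij; have := ltm_solveP A (fun k => (k == j)%:R) i.
  rewrite big_ord_recr /= big1 ?add0r => [|k _]; last first.
    by rewrite IH ?mulr0 //; apply: ltn_trans ij.
  rewrite ltn_eqF // => /eqP; rewrite mulf_eq0 (negPf (ltm_diag A i)).
  by move=> /eqP.
split=> // i; apply/eqP => xi0.
have := ltm_solveP A (fun k => (k == i)%:R) i.
rewrite big_ord_recr /= xi0 mulr0 addr0 big1 => [|k _]; last first.
  by rewrite up ?mulr0.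
by rewrite eqxx => /eqP; rewrite eq_sym oner_eq0.
Qed.
Definition ltm_inv A := LTMatrix (ltm_inv_subproof A).

Fact ltm_mulV : right_inverse ltm_one ltm_inv ltm_mul.
Proof. by move=> A; apply: ltm_eq => i j; apply: ltm_solveP. Qed.

Fact ltm_Vmul : left_inverse ltm_one ltm_inv ltm_mul.
Proof.
move=> A; have AB := ltm_mulV A; have BC := ltm_mulV (ltm_inv A).
have AC : ltm_inv (ltm_inv A) = A.
  by rewrite -[LHS]ltm_1mul -AB -ltm_mulA BC ltm_mul1.
by rewrite -[in RHS]BC AC.
Qed.

HB.instance Definition _ :=
  isGroup.Build ltmatrix ltm_mulA ltm_1mul ltm_mul1 ltm_Vmul ltm_mulV.

Lemma ltmME A B i j : (A * B)%g i j = \sum_(k < i.+1) A i k * B k j.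
Proof. by []. Qed.

Lemma ltm1E i j : (1%g : ltmatrix) i j = (i == j)%:R.
Proof. by []. Qed.

End TriangularGroup.

Record subgroup_of (G : groupType) (S : {pred G}) (clS : group_closed S) :=
  SubgroupOf { subgroup_elt : G; subgroup_eltP : S subgroup_elt }.

Section SubgroupTheory.
Variables (G : groupType) (S : {pred G}) (clS : group_closed S).

HB.instance Definition _ := [isSub of subgroup_of clS for @subgroup_elt _ _ clS].
HB.instance Definition _ := [Choice of subgroup_of clS by <:].
HB.instance Definition _ :=
  SubChoice_isSubGroup.Build G S (subgroup_of clS) clS.

Lemma subgroup_eltM (x y : subgroup_of clS) : subgroup_elt (x * y)%g = (subgroup_elt x * subgroup_elt y)%g.
Proof. exact: (valM (x : subgroup_of clS)). Qed.

Lemma subgroup_elt_inj : injective (@subgroup_elt _ _ clS).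
Proof. exact: val_inj. Qed.

End SubgroupTheory.


Section RiordanGroup.
Variable K : fieldType.
Implicit Types f g a b u v : fps K.
Implicit Types A B : ltmatrix K.

(* Coefficient i of the generating function of column k of (g, f). *)
Definition riordan_entry g f : nat -> nat -> K := fun i k => (g * f ^+ k) i.

Fact riordan_mx_subproof g f : g \in fps_unit0 -> f \in fps_ord1 ->
  lt_invertible (riordan_entry g f).
Proof.
rewrite !unfold_in => g0 /andP[/eqP f0 f1].
split=> [i k ik|i]; rewrite /riordan_entry fpsME.
  rewrite big1 // => j _; rewrite fps_expE ?mulr0 //.
  exact: leq_ltn_trans (leq_subr _ _) ik.
rewrite big_ord_recl /= subn0 fps_exp_diag // big1 => [|j _].
  by rewrite addr0 mulf_neq0 // expf_neq0.
rewrite fps_expE ?mulr0 // ltn_subrL /=.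
exact: leq_ltn_trans (leq0n j) (ltn_ord j).
Qed.
Definition riordan_mx g f (g0 : g \in fps_unit0) (f1 : f \in fps_ord1) :=
  LTMatrix (riordan_mx_subproof g0 f1).

Definition is_riordan : {pred ltmatrix K} := fun A =>
  `[< exists g f (g0 : g \in fps_unit0) (f1 : f \in fps_ord1),
        A = riordan_mx g0 f1 >].

Lemma is_riordanP A :
  reflect (exists g f, [/\ g \in fps_unit0, f \in fps_ord1 &
                           forall i k, A i k = (g * f ^+ k) i])
          (A \in is_riordan).
Proof.
apply: (iffP (asboolP _)) => [[g [f [g0 [f1 ->]]]]|[g [f [g0 f1 AE]]]].
  by exists g, f.
by exists g, f, g0, f1; apply: ltm_eq.
Qed.

Lemma riordan_col g f a n : f 0 = 0 ->
  \sum_(k < n.+1) riordan_entry g f n k * a k = (g * fps_comp a f) n.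
Proof.
move=> f0; rewrite fpsME.
under eq_bigr => k _ do rewrite /riordan_entry fpsME mulr_suml.
rewrite exchange_big; apply: eq_bigr => i _.
rewrite (fps_comp_wide _ f0 (leq_subr i n)) mulr_sumr.
by apply: eq_bigr => k _; rewrite -mulrA [a k * _]mulrC.
Qed.

Lemma riordan_entryM g f a b n k : f 0 = 0 ->
  ltm_mul_entry (riordan_entry g f) (riordan_entry a b) n k =
  riordan_entry (g * fps_comp a f) (fps_comp b f) n k.
Proof.
move=> f0; rewrite /ltm_mul_entry riordan_col //.
by rewrite fps_compM // fps_compXn // mulrA.
Qed.

Lemma riordan_entry1 n k : riordan_entry 1 fpsX n k = (n == k)%:R.
Proof. by rewrite /riordan_entry mul1r fpsXnE. Qed.

Lemma riordan_solve g f b : g \in fps_unit0 -> f \in fps_ord1 ->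
  exists a, g * fps_comp a f = b.
Proof.
move=> g0 f1; exists (Fps (ltm_solve (riordan_mx g0 f1) b)).
apply: fpsP => n; rewrite -riordan_col ?fps_ord1_0 //.
exact: (ltm_solveP (riordan_mx g0 f1)).
Qed.

Lemma riordan_solve_unit0 g f b : g \in fps_unit0 -> f \in fps_ord1 ->
  b \in fps_unit0 -> exists2 a, a \in fps_unit0 & g * fps_comp a f = b.
Proof.
move=> g0 f1 b0; have [a ab] := riordan_solve b g0 f1; exists a => //.
move: b0; rewrite !unfold_in -ab fpsM0E fps_comp0E.
by apply: contraNN => /eqP ->; rewrite mulr0.
Qed.

Lemma riordan_inv g f : g \in fps_unit0 -> f \in fps_ord1 ->
  exists a b, [/\ a \in fps_unit0, b \in fps_ord1,
                  g * fps_comp a f = 1 & fps_comp b f = fpsX].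
Proof.
move=> g0 f1; have f0 := fps_ord1_0 f1.
have u1 : (1 : fps K) \in fps_unit0 by rewrite unfold_in /= oner_neq0.
have [a a0 ga] := riordan_solve_unit0 g0 f1 u1.
have d0 := fps_divX_unit0 f1.
have [c c0 fc] := riordan_solve_unit0 d0 f1 u1.
exists a, (fpsX * c); split=> //; first by rewrite fps_mulX_ord1.
by rewrite fps_compM // fps_compXf // -{1}(fps_divXK f0) -mulrA fc mulr1.
Qed.

Fact riordan_closed : group_closed is_riordan.
Proof.
split=> [|A B].
  apply/is_riordanP; exists 1, fpsX; split.
  - by rewrite unfold_in /= oner_neq0.
  - exact: fpsX_ord1.
  - by move=> i k; rewrite ltm1E -riordan_entry1.
move=> /is_riordanP[g [f [g0 f1 AE]]] /is_riordanP[p [q [p0 q1 BE]]].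
have [a [b [a0 b1 pa qb]]] := riordan_inv p0 q1.
have Binv : (B^-1)%g = riordan_mx a0 b1.
  apply: (mulgI B); rewrite mulgV; apply: ltm_eq => i k.
  rewrite ltm1E ltmME /=; under eq_bigr => j _ do rewrite BE.
  have := riordan_entryM p a b i k (fps_ord1_0 q1).
  rewrite pa qb riordan_entry1 => <-; apply: eq_bigr => j _.
  by [].
rewrite Binv; apply/is_riordanP.
exists (g * fps_comp a f), (fps_comp b f); split.
- exact/fps_unit0M/fps_comp_unit0.
- exact: fps_comp_ord1.
- move=> i k; rewrite -[RHS](riordan_entryM g a b i k (fps_ord1_0 f1)).
  by rewrite ltmME; apply: eq_bigr => j _; rewrite AE.
Qed.

Definition riordan := subgroup_of riordan_closed.
HB.instance Definition _ := Group.on riordan.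

Fact riordan_array_subproof g f (g0 : g \in fps_unit0) (f1 : f \in fps_ord1) :
  is_riordan (riordan_mx g0 f1).
Proof. by apply/is_riordanP; exists g, f. Qed.

(* The Riordan array (g, f). *)
Definition riordan_array g f (g0 : g \in fps_unit0) (f1 : f \in fps_ord1)
  : riordan := SubgroupOf riordan_closed (riordan_array_subproof g0 f1).

Lemma riordanP (A : riordan) :
  exists g f (g0 : g \in fps_unit0) (f1 : f \in fps_ord1),
    A = riordan_array g0 f1.
Proof.
have /asboolP[g [f [g0 [f1 AE]]]] := subgroup_eltP A.
by exists g, f, g0, f1; apply: subgroup_elt_inj.
Qed.

Lemma fps_mulI f : f \in fps_unit0 -> injective (fun g => f * g).
Proof.
move=> f0 g h /= fgh; have u1 : (1 : fps K) \in fps_unit0.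
  by rewrite unfold_in /= oner_neq0.
have [a _ fa] := riordan_solve_unit0 f0 (fpsX_ord1 K) u1.
by rewrite -[g]mul1r -[h]mul1r -fa -!mulrA ![fps_comp _ _ * _]mulrC !mulrA fgh.
Qed.

Lemma fps_mulI1 f : f \in fps_ord1 -> injective (fun g => f * g).
Proof.
move=> f1 g h /=; rewrite -{1 2}(fps_divXK (fps_ord1_0 f1)) -!mulrA.
by move=> /fps_mulXI; apply/fps_mulI/fps_divX_unit0.
Qed.

Lemma riordan_arrayM g f a b
    (g0 : g \in fps_unit0) (f1 : f \in fps_ord1)
    (a0 : a \in fps_unit0) (b1 : b \in fps_ord1) :
  (riordan_array g0 f1 * riordan_array a0 b1)%g =
  riordan_array (fps_unit0M g0 (fps_comp_unit0 f a0)) (fps_comp_ord1 b1 f1).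
Proof.
apply: subgroup_elt_inj; rewrite subgroup_eltM; apply: ltm_eq => i k.
exact/riordan_entryM/fps_ord1_0.
Qed.

Lemma riordan_array_inj g f a b
    (g0 : g \in fps_unit0) (f1 : f \in fps_ord1)
    (a0 : a \in fps_unit0) (b1 : b \in fps_ord1) :
  riordan_array g0 f1 = riordan_array a0 b1 -> (g, f) = (a, b).
Proof.
move=> /(congr1 (@subgroup_elt _ _ _)) /= E.
have {}E k : g * f ^+ k = a * b ^+ k.
  apply: fpsP => i.
  exact: (congr1 (fun M : ltmatrix K => M i k) E).
have ga : g = a by have := E 0; rewrite !expr0 !mulr1.
by have := E 1; rewrite !expr1 -ga => /(fps_mulI g0) ->.
Qed.

Fact riordan_series_subproof (A : riordan) :
  exists p : fps K * fps K,
    exists (g0 : p.1 \in fps_unit0) (f1 : p.2 \in fps_ord1),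
      A = riordan_array g0 f1.
Proof. by have [g [f AE]] := riordanP A; exists (g, f). Qed.

(* The pair (g, f) of which A is the Riordan array; it is unique, see         *)
(* [riordan_array_inj].                                                       *)
Definition riordan_series (A : riordan) : fps K * fps K :=
  sval (cid (riordan_series_subproof A)).

Lemma riordan_series_unit0 (A : riordan) :
  (riordan_series A).1 \in fps_unit0.
Proof. by rewrite /riordan_series; case: cid => p []. Qed.

Lemma riordan_series_ord1 (A : riordan) :
  (riordan_series A).2 \in fps_ord1.
Proof. by rewrite /riordan_series; case: cid => p [? []]. Qed.

Lemma riordan_arrayK g f (g0 : g \in fps_unit0) (f1 : f \in fps_ord1) :
  riordan_series (riordan_array g0 f1) = (g, f).
Proof.
rewrite /riordan_series; case: cid => -[a b] /= [a0 [b1 E]].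
by rewrite (riordan_array_inj E).
Qed.

End RiordanGroup.

Section DoubleRiordanGroup.
Variable K : fieldType.
Implicit Types f g h a b c u v w x : fps K.
Implicit Types A B : ltmatrix K.

Definition even_unit0 g := fps_even g /\ g \in fps_unit0.
Definition odd_ord1 f := fps_odd f /\ f \in fps_ord1.

(* Coefficient i of the generating function of column k of (g, f1, f2); the   *)
(* columns are g, g f1, g f1 f2, g f1 (f1 f2), g (f1 f2)^2, etc.              *)
Definition double_riordan_entry g f1 f2 : nat -> nat -> K :=
  fun i k => (g * f1 ^+ uphalf k * f2 ^+ k./2) i.

Lemma fpsXnME f k n : (fpsX ^+ k * f) n = if (n < k)%N then 0 else f (n - k)%N.
Proof.
elim: k n => [|k IH] n; first by rewrite expr0 mul1r subn0.
by rewrite exprS -mulrA fpsXME; case: n => // n; rewrite IH ltnS subSS.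
Qed.

Fact double_riordan_mx_subproof g f1 f2 :
  even_unit0 g -> odd_ord1 f1 -> odd_ord1 f2 ->
  lt_invertible (double_riordan_entry g f1 f2).
Proof.
move=> [_ g0] [_ f11] [_ f21].
have f10 := fps_divX_unit0 f11; have f20 := fps_divX_unit0 f21.
rewrite /double_riordan_entry.
rewrite -(fps_divXK (fps_ord1_0 f11)) -(fps_divXK (fps_ord1_0 f21)).
set u := fps_divX f1 in f10 *; set v := fps_divX f2 in f20 *.
have E k : g * (fpsX * u) ^+ uphalf k * (fpsX * v) ^+ k./2 =
    fpsX ^+ k * (g * u ^+ uphalf k * v ^+ k./2).
  have -> : fpsX ^+ k = fpsX ^+ uphalf k * fpsX ^+ k./2 :> fps K.
    by rewrite -exprD uphalf_half -addnA addnn odd_double_half.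
  rewrite !exprMn -!mulrA [LHS]mulrCA; congr (_ * _).
  by rewrite [RHS]mulrCA; congr (_ * _); rewrite [RHS]mulrCA.
split=> [i k ik|i]; rewrite E fpsXnME ?ik // ltnn subnn.
by rewrite !fpsM0E !fpsXn0E !mulf_neq0 ?expf_neq0.
Qed.
Definition double_riordan_mx g f1 f2
    (hg : even_unit0 g) (h1 : odd_ord1 f1) (h2 : odd_ord1 f2) :=
  LTMatrix (double_riordan_mx_subproof hg h1 h2).

Definition is_double_riordan : {pred ltmatrix K} := fun A =>
  `[< exists g f1 f2
        (hg : even_unit0 g) (h1 : odd_ord1 f1) (h2 : odd_ord1 f2),
        A = double_riordan_mx hg h1 h2 >].

Lemma even_unit0P g :
  even_unit0 g <-> exists2 a, a \in fps_unit0 & g = fps_sq a.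
Proof.
split=> [[/fps_evenP[a ->]]|[a a0 ->]].
  by rewrite fps_sq_unit0 => a0; exists a.
by split; [exact: fps_sq_even | rewrite fps_sq_unit0].
Qed.

Lemma odd_ord1P f :
  odd_ord1 f <-> exists2 u, u \in fps_unit0 & f = fpsX * fps_sq u.
Proof.
split=> [[/fps_oddP[u ->]]|[u u0 ->]].
  by rewrite fps_mulX_ord1 fps_sq_unit0 => u0; exists u.
split; last by rewrite fps_mulX_ord1 fps_sq_unit0.
exact/fps_mulX_odd/fps_sq_even.
Qed.

Lemma is_double_riordanP A :
  reflect (exists a u v, [/\ a \in fps_unit0, u \in fps_unit0,
             v \in fps_unit0 & forall i k, A i k =
             double_riordan_entry (fps_sq a) (fpsX * fps_sq u)
                                  (fpsX * fps_sq v) i k])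
          (A \in is_double_riordan).
Proof.
apply: (iffP (asboolP _)) => [[g [f1 [f2 [hg [h1 [h2 ->]]]]]]|].
  have /even_unit0P[a a0 Ea] := hg; have /odd_ord1P[u u0 Eu] := h1.
  have /odd_ord1P[v v0 Ev] := h2; exists a, u, v; split=> // i k.
  by rewrite -Ea -Eu -Ev.
move=> [a [u [v [a0 u0 v0 AE]]]].
have hg : even_unit0 (fps_sq a) by apply/even_unit0P; exists a.
have h1 : odd_ord1 (fpsX * fps_sq u) by apply/odd_ord1P; exists u.
have h2 : odd_ord1 (fpsX * fps_sq v) by apply/odd_ord1P; exists v.
by do 3 eexists; exists hg, h1, h2; apply: ltm_eq.
Qed.

(* The rows and columns of even (resp. odd) index of a double Riordan array   *)
(* form a Riordan array.                                                      *)
Lemma double_riordan_entryE a u v i k :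
  double_riordan_entry (fps_sq a) (fpsX * fps_sq u) (fpsX * fps_sq v) i k =
  if odd i == odd k
  then riordan_entry (if odd k then a * u else a) (fpsX * u * v) i./2 k./2
  else 0.
Proof.
rewrite /double_riordan_entry /riordan_entry uphalf_half exprD.
set m := k./2; set q := fpsX * u * v.
have E : (fpsX * fps_sq u) ^+ m * (fpsX * fps_sq v) ^+ m =
         fps_sq (q ^+ m).
  by rewrite -exprMn fps_sqXn !fps_sqM fps_sqX mulrACA mulrA.
case: (odd k); last first.
  rewrite expr0 mul1r -mulrA E -fps_sqM fps_sqE.
  by case: (odd i).
rewrite expr1 -!mulrA E mulrCA -!fps_sqM fpsXME.
case: i => [//|i]; rewrite fps_sqE -[odd i.+1]/(~~ odd i).
rewrite -[i.+1./2]/(uphalf i) uphalf_half.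
by case: (odd i); rewrite // mulrA add0n.
Qed.

Lemma big_ord_parity (F : nat -> K) i :
  \sum_(j < i.+1) (if odd i == odd j then F j./2 else 0) =
  \sum_(l < i./2.+1) F l.
Proof.
elim/ltn_ind: i => -[|[|i]] IH; first by rewrite !big_ord1.
  by rewrite big_ord_recl !big_ord1 /= add0r.
rewrite 2!big_ord_recr [RHS]big_ord_recr /= -IH //.
rewrite !negbK eqxx; congr (_ + _).
by case: (odd i); rewrite /= addr0.
Qed.

Lemma double_riordan_entryM a u v b w x i k : let q := fpsX * u * v in
  ltm_mul_entry
    (double_riordan_entry (fps_sq a) (fpsX * fps_sq u) (fpsX * fps_sq v))
    (double_riordan_entry (fps_sq b) (fpsX * fps_sq w) (fpsX * fps_sq x)) i k =
  double_riordan_entry (fps_sq (a * fps_comp b q))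
    (fpsX * fps_sq (u * fps_comp w q)) (fpsX * fps_sq (v * fps_comp x q)) i k.
Proof.
move=> q; have q0 : q 0 = 0 by rewrite /q -mulrA fpsXME.
rewrite double_riordan_entryE /ltm_mul_entry.
have [ik|ik] := eqVneq (odd i) (odd k); last first.
  rewrite big1 // => j _; rewrite !double_riordan_entryE.
  case: eqP => [ij|]; last by rewrite mul0r.
  by rewrite -ij (negPf ik) mulr0.
transitivity (\sum_(j < i.+1) if odd i == odd j then
    riordan_entry (if odd k then a * u else a) q i./2 j./2 *
    riordan_entry (if odd k then b * w else b) (fpsX * w * x) j./2 k./2
  else 0).
  apply: eq_bigr => j _; rewrite !double_riordan_entryE -ik.
  by case: eqP => [<-|_]; rewrite ?eqxx ?mul0r.
rewrite (big_ord_parity (fun j =>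
    riordan_entry (if odd k then a * u else a) q i./2 j *
    riordan_entry (if odd k then b * w else b) (fpsX * w * x) j k./2)).
rewrite -[LHS]/(ltm_mul_entry _ _ _ _) riordan_entryM // !fps_compM //.
rewrite fps_compXf //; congr (riordan_entry _ _ _ _).
  by case: (odd k); rewrite ?fps_compM // mulrACA.
by rewrite {1}/q -!mulrA; congr (_ * (_ * _)); rewrite mulrCA.
Qed.

Fact double_riordan_closed : group_closed is_double_riordan.
Proof.
have u1 : (1 : fps K) \in fps_unit0 by rewrite unfold_in /= oner_neq0.
have E1 i k : double_riordan_entry (fps_sq 1) (fpsX * fps_sq 1)
    (fpsX * fps_sq 1) i k = (i == k)%:R.
  rewrite /double_riordan_entry /fps_sq fps_comp1 mulr1 mul1r -exprD.
  by rewrite uphalf_half -addnA addnn odd_double_half fpsXnE.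
split=> [|A B]; first by apply/is_double_riordanP; exists 1, 1, 1; split.
move=> /is_double_riordanP[a [u [v [a0 u0 v0 AE]]]].
move=> /is_double_riordanP[b [w [x [b0 w0 x0 BE]]]].
have q1 : fpsX * w * x \in fps_ord1.
  by rewrite -mulrA fps_mulX_ord1 fps_unit0M.
have [b' b'0 bE] := riordan_solve_unit0 b0 q1 u1.
have [w' w'0 wE] := riordan_solve_unit0 w0 q1 u1.
have [x' x'0 xE] := riordan_solve_unit0 x0 q1 u1.
have hg : even_unit0 (fps_sq b') by apply/even_unit0P; exists b'.
have h1 : odd_ord1 (fpsX * fps_sq w') by apply/odd_ord1P; exists w'.
have h2 : odd_ord1 (fpsX * fps_sq x') by apply/odd_ord1P; exists x'.
have Binv : (B^-1)%g = double_riordan_mx hg h1 h2.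
  apply: (mulgI B); rewrite mulgV; apply: ltm_eq => i k.
  rewrite ltm1E ltmME /=; under eq_bigr => j _ do rewrite BE.
  have := double_riordan_entryM b w x b' w' x' i k.
  by rewrite /= bE wE xE E1 => <-.
rewrite Binv; apply/is_double_riordanP.
set q := fpsX * u * v.
exists (a * fps_comp b' q), (u * fps_comp w' q), (v * fps_comp x' q).
split; try by apply/fps_unit0M/fps_comp_unit0.
move=> i k; rewrite -double_riordan_entryM.
by rewrite ltmME; apply: eq_bigr => j _; rewrite AE.
Qed.

Definition double_riordan := subgroup_of double_riordan_closed.
HB.instance Definition _ := Group.on double_riordan.

Fact double_riordan_array_subproof g f1 f2
    (hg : even_unit0 g) (h1 : odd_ord1 f1) (h2 : odd_ord1 f2) :
  is_double_riordan (double_riordan_mx hg h1 h2).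
Proof. by apply/asboolP; exists g, f1, f2, hg, h1, h2. Qed.

(* The double Riordan array (g, f1, f2). *)
Definition double_riordan_array g f1 f2
    (hg : even_unit0 g) (h1 : odd_ord1 f1) (h2 : odd_ord1 f2)
  : double_riordan :=
  SubgroupOf double_riordan_closed (double_riordan_array_subproof hg h1 h2).

Lemma double_riordanP (A : double_riordan) :
  exists g f1 f2 (hg : even_unit0 g) (h1 : odd_ord1 f1) (h2 : odd_ord1 f2),
    A = double_riordan_array hg h1 h2.
Proof.
have /asboolP[g [f1 [f2 [hg [h1 [h2 AE]]]]]] := subgroup_eltP A.
by exists g, f1, f2, hg, h1, h2; apply: subgroup_elt_inj.
Qed.

(* For any square root h of f1 f2, the product of (g, f1, f2) and (G, F1, F2) *)
(* is (g G(h), (f1 / h) F1(h), (f2 / h) F2(h)).                               *)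
Lemma double_riordan_arrayM g f1 f2 G F1 F2 h p1 p2
    (hg : even_unit0 g) (h1 : odd_ord1 f1) (h2 : odd_ord1 f2)
    (hG : even_unit0 G) (H1 : odd_ord1 F1) (H2 : odd_ord1 F2)
    (hp : even_unit0 (g * fps_comp G h)) (hp1 : odd_ord1 p1)
    (hp2 : odd_ord1 p2) :
  h \in fps_ord1 -> h ^+ 2 = f1 * f2 ->
  h * p1 = f1 * fps_comp F1 h -> h * p2 = f2 * fps_comp F2 h ->
  (double_riordan_array hg h1 h2 * double_riordan_array hG H1 H2)%g =
  double_riordan_array hp hp1 hp2.
Proof.
move=> hord h_sq E1 E2; have h0 := fps_ord1_0 hord.
apply: subgroup_elt_inj; rewrite subgroup_eltM; apply: ltm_eq => i k /=.
have /even_unit0P[a _ Ea] := hg; have /odd_ord1P[u _ Eu] := h1.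
have /odd_ord1P[v _ Ev] := h2; have /even_unit0P[b _ Eb] := hG.
have /odd_ord1P[w _ Ew] := H1; have /odd_ord1P[x _ Ex] := H2.
set q := fpsX * u * v; have q0 : q 0 = 0 by rewrite /q -mulrA fpsXME.
have sqh c : fps_comp (fps_sq c) h = fps_sq (fps_comp c q).
  rewrite fps_compA ?fpsX2_0 // fps_compXn // fps_compXf // h_sq Eu Ev.
  rewrite [LHS](_ : _ = fps_comp c (fps_sq q)).
    by rewrite /fps_sq fps_compA ?fpsX2_0.
  by congr fps_comp; rewrite /q !fps_sqM fps_sqX mulrACA mulrA.
have Xsqh c f p : h * p = f * fps_comp (fpsX * fps_sq c) h ->
    p = f * fps_sq (fps_comp c q).
  move=> E; apply: (fps_mulI1 hord); rewrite /= E fps_compM // fps_compXf //.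
  by rewrite sqh mulrCA.
rewrite -[LHS]/(ltm_mul_entry _ _ _ _).
rewrite Ew in E1; rewrite Ex in E2; rewrite (Xsqh _ _ _ E1) (Xsqh _ _ _ E2).
rewrite Ea Eb Eu Ev Ew Ex double_riordan_entryM sqh.
by rewrite !fps_sqM !mulrA.
Qed.

End DoubleRiordanGroup.

Section Phi.
Variable K : fieldType.
Implicit Types f g : fps K.

Lemma even_unit0_sq g : g \in fps_unit0 -> even_unit0 (fps_sq g).
Proof. by move=> g0; split; [exact: fps_sq_even | rewrite fps_sq_unit0]. Qed.

Lemma odd_ord1X : odd_ord1 (@fpsX K).
Proof. by split; [exact: fpsX_odd | exact: fpsX_ord1]. Qed.

Lemma odd_ord1_divX_sq f : f \in fps_ord1 -> odd_ord1 (fps_divX (fps_sq f)).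
Proof.
by move=> f1; split; [exact: fps_divX_sq_odd | exact: fps_divX_sq_ord1].
Qed.

(* The double Riordan array (g(z^2), z, f(z^2) / z). *)
Definition almost_appell_array g f (g0 : g \in fps_unit0) (f1 : f \in fps_ord1)
  : double_riordan K :=
  double_riordan_array (even_unit0_sq g0) odd_ord1X (odd_ord1_divX_sq f1).

Definition phi (A : riordan K) : double_riordan K :=
  almost_appell_array (riordan_series_unit0 A) (riordan_series_ord1 A).

Lemma phiE g f (g0 : g \in fps_unit0) (f1 : f \in fps_ord1) :
  phi (riordan_array g0 f1) = almost_appell_array g0 f1.
Proof.
rewrite /phi; move: (riordan_series_unit0 _) (riordan_series_ord1 _).
rewrite riordan_arrayK /= => g0' f1'.
by rewrite (bool_irrelevance g0' g0) (bool_irrelevance f1' f1).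
Qed.

Definition type1_almost_appell : {pred double_riordan K} := fun A =>
  `[< exists g f (g0 : g \in fps_unit0) (f1 : f \in fps_ord1),
        A = almost_appell_array g0 f1 >].

End Phi.

(* Main.v *)
Require Import Defs.
From HB Require Import structures.
From mathcomp Require Import all_boot all_order all_algebra.
From mathcomp Require Import boolp.
From mathcomp Require Import reals complex.

(** With f = z u, the array phi(g, f) is (g(z^2), z, z u(z^2)). Multiplying two
    such arrays substitutes z^2 u(z^2) = f(z^2) for z^2, so no square root of
    f(z^2) is needed, and phi is a morphism over every field. *)

Set Implicit Arguments.
Unset Strict Implicit.
Unset Printing Implicit Defensive.

Import GRing.Theory.
Local Open Scope ring_scope.

Section PhiMorphism.
Variable K : fieldType.
Implicit Types f g : fps K.

(** Substituting f in b = z (b/z) gives b(f) = f (b/z)(f), and a factor z cancels. This matches the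
    third component of a product of arrays. *)
Lemma fps_divX_comp (b f : fps K) : b 0 = 0 -> f 0 = 0 ->
  fps_divX (fps_comp b f) = fps_divX f * fps_comp (fps_divX b) f.
Proof.
move=> b0 f0; apply: fps_mulXI; rewrite fps_divXK ?fps_comp0E //.
rewrite mulrA fps_divXK // -{2}(fps_compXf f0) -fps_compM //.
by rewrite fps_divXK.
Qed.

(** Both multipliers take the shape z u(z^2), with u = 1 and u = f/z, which [double_riordan_entryM]
    expects. *)
Lemma almost_appell_array_entry g f (g0 : g \in fps_unit0)
    (f1 : f \in fps_ord1) :
  ltm_entry (subgroup_elt (almost_appell_array g0 f1)) =
  double_riordan_entry (fps_sq g) (fpsX * fps_sq 1)
    (fpsX * fps_sq (fps_divX f)).
Proof.
by rewrite /= fps_divX_sqE ?fps_ord1_0 // /fps_sq fps_comp1 mulr1.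
Qed.

Lemma almost_appell_arrayM g f a b
    (g0 : g \in fps_unit0) (f1 : f \in fps_ord1)
    (a0 : a \in fps_unit0) (b1 : b \in fps_ord1) :
  (almost_appell_array g0 f1 * almost_appell_array a0 b1)%g =
  almost_appell_array (fps_unit0M g0 (fps_comp_unit0 f a0))
    (fps_comp_ord1 b1 f1).
Proof.
have f0 := fps_ord1_0 f1; have b0 := fps_ord1_0 b1.
apply: subgroup_elt_inj; rewrite subgroup_eltM; apply: ltm_eq => i k.
rewrite -[LHS]/(ltm_mul_entry _ _ _ _) !almost_appell_array_entry.
(* The series substituted by [double_riordan_entryM] is z * 1 * (f/z) = f, as in the Riordan
   product. *)
by rewrite double_riordan_entryM mulr1 fps_divXK // fps_divX_comp // fps_comp1
  mulr1.
Qed.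

Lemma almost_appell_array_inj g f a b
    (g0 : g \in fps_unit0) (f1 : f \in fps_ord1)
    (a0 : a \in fps_unit0) (b1 : b \in fps_ord1) :
  almost_appell_array g0 f1 = almost_appell_array a0 b1 -> (g, f) = (a, b).
Proof.
move=> /(congr1 (fun A => ltm_entry (subgroup_elt A))) E.
rewrite !almost_appell_array_entry /double_riordan_entry in E.
have {}E k : fps_sq g * (fpsX * fps_sq 1) ^+ uphalf k
      * (fpsX * fps_sq (fps_divX f)) ^+ k./2 =
    fps_sq a * (fpsX * fps_sq 1) ^+ uphalf k
      * (fpsX * fps_sq (fps_divX b)) ^+ k./2.
  by apply: fpsP => i; exact: (congr1 (fun M => M i k) E).
have ga : g = a by apply: fps_sq_inj; have := E 0; rewrite !expr0 !mulr1.
(* Column 1 is z g(z^2), free of f; column 2 is the first to involve f. *)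
have := E 2; rewrite /= !expr1 -ga -!mulrA.
have sg0 : fps_sq g \in fps_unit0 by rewrite fps_sq_unit0.
move=> /(fps_mulI sg0)/fps_mulXI; rewrite /fps_sq fps_comp1 !mul1r.
move=> /fps_mulXI/fps_sq_inj fb.
by rewrite -(fps_divXK (fps_ord1_0 f1)) fb fps_divXK ?fps_ord1_0.
Qed.

Lemma phiM : {morph @phi K : A B / (A * B)%g}.
Proof.
move=> A B; have [g [f [g0 [f1 ->]]]] := riordanP A.
have [a [b [a0 [b1 ->]]]] := riordanP B.
by rewrite riordan_arrayM !phiE almost_appell_arrayM.
Qed.

Lemma phi_one : phi 1%g = 1%g :> double_riordan K.
(* An idempotent of a group is the identity. *)
Proof. by apply: (mulgI (phi 1%g)); rewrite -phiM !mulg1. Qed.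

HB.instance Definition _ :=
  isUMagmaMorphism.Build _ _ (@phi K) (phi_one, phiM).

Lemma phi_inj : injective (@phi K).
Proof.
move=> A B; have [g [f [g0 [f1 ->]]]] := riordanP A.
have [a [b [a0 [b1 ->]]]] := riordanP B.
rewrite !phiE => /almost_appell_array_inj[ga fb].
(* The arrays carry proofs about their series; the entries do not, so the equalities can be
   rewritten there. *)
apply: subgroup_elt_inj; apply: ltm_eq => i k.
by rewrite /= ga fb.
Qed.

(** Seeing the subset as the image of [phi] yields both its closure as a subgroup and the
    surjectivity of [phi1]. *)
Lemma type1_almost_appellP (A : double_riordan K) :
  reflect (exists B, A = phi B) (A \in @type1_almost_appell K).
Proof.
apply: (iffP (asboolP _)) => [[g [f [g0 [f1 ->]]]]|[B ->]].
  by exists (riordan_array g0 f1); rewrite phiE.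
have [g [f [g0 [f1 ->]]]] := riordanP B.
by exists g, f, g0, f1; rewrite phiE.
Qed.

Lemma type1_almost_appell_closed : group_closed (@type1_almost_appell K).
Proof.
split=> [|_ _ /type1_almost_appellP[A ->] /type1_almost_appellP[B ->]].
  by apply/type1_almost_appellP; exists 1%g; rewrite gmulf1.
by apply/type1_almost_appellP; exists (A * B^-1)%g; rewrite gmulfF.
Qed.

Lemma phi_type1 (A : riordan K) : type1_almost_appell (phi A).
Proof. by apply/type1_almost_appellP; exists A. Qed.

Definition phi1 (A : riordan K) : subgroup_of type1_almost_appell_closed :=
  SubgroupOf type1_almost_appell_closed (phi_type1 A).

Lemma phi1M : {morph phi1 : A B / (A * B)%g}.
Proof. by move=> A B; apply: subgroup_elt_inj; rewrite subgroup_eltM /= phiM. Qed.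

HB.instance Definition _ := isMultiplicative.Build _ _ phi1 phi1M.

Lemma phi1_bij : bijective phi1.
Proof.
have surj (B : subgroup_of type1_almost_appell_closed) : exists A, phi1 A = B.
  have /type1_almost_appellP[A BE] := subgroup_eltP B.
  by exists A; apply: subgroup_elt_inj.
(* The inverse chooses a preimage; injectivity of [phi] makes it unique. *)
exists (fun B => sval (cid (surj B))) => [A|B]; last by case: cid.
by case: cid => A' /= /(congr1 (@subgroup_elt _ _ _))/phi_inj.
Qed.

End PhiMorphism.

Theorem theorem2p1 (R : realType) :
  ({morph @phi R[i] : A B / (A * B)%g} /\ injective (@phi R[i])) /\
  (exists (cl : group_closed (@type1_almost_appell R[i]))
          (psi : {multiplicative riordan R[i] -> subgroup_of cl}),
     bijective psi).
Proof.
split; first by split; [exact: phiM | exact: phi_inj].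
exists (type1_almost_appell_closed R[i]), (@phi1 R[i]).
exact: phi1_bij.
Qed.
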